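(* $\mathfrak{p}= \min \{\kappa : \kappa \text{ is a cardinal and } 2^\kappa \text{ is not CDH}\}$.
   Context: A separable topological space $X$ is countable dense homogeneous (CDH) if for any two countable dense subsets $D, D' \subseteq X$ there is a homeomorphism $h : X \to X$ such that $h[D]=D'$ (in particular, a CDH space is separable). For a cardinal $\kappa$, $2^\kappa$ denotes the product of $\kappa$ copies of the two-point discrete space, with the product topology. $[\omega]^\omega$ is the set of infinite subsets of $\omega$. A family $\mathcal{F}\subseteq[\omega]^\omega$ is centered if every non-empty finite subfamily of $\mathcal{F}$ has an infinite intersection. An infinite set $A\subseteq\omega$ is a pseudo-intersection of $\mathcal{F}$ if $A\setminus F$ is finite for every $F\in\mathcal{F}$. The cardinal $\mathfrak{p}$ is the minimal cardinality of a centered family $\mathcal{F}\subseteq[\omega]^\omega$ which has no infinite pseudo-intersection. *)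

(* Defs.v *)
From HB Require Import structures.
From mathcomp Require Import all_boot all_order all_algebra.
From mathcomp Require Import boolp classical_sets functions cardinality.
From mathcomp Require Import reals topology function_spaces.

Set Implicit Arguments.
Unset Strict Implicit.
Unset Printing Implicit Defensive.

Local Open Scope classical_set_scope.
Local Open Scope card_scope.

Definition separable_space (X : topologicalType) : Prop :=
  exists D : set X, countable D /\ dense D.

Definition homeomorphism (X Y : topologicalType) (h : X -> Y) : Prop :=
  exists g : Y -> X,
    [/\ cancel h g, cancel g h, continuous h & continuous g].

(* [countable] includes finite sets, so finite discrete spaces are covered. *)
Definition countable_dense_homogeneous (X : topologicalType) : Prop :=
  separable_space X /\
  forall D D' : set X,
    countable D -> dense D -> countable D' -> dense D' ->
    exists h : X -> X, homeomorphism h /\ h @` D = D'.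

Definition centered (F : set (set nat)) : Prop :=
  forall G : set (set nat),
    finite_set G -> G !=set0 -> G `<=` F ->
    infinite_set (\bigcap_(A in G) A).

Definition pseudo_intersection (F : set (set nat)) (A : set nat) : Prop :=
  infinite_set A /\ forall B, F B -> finite_set (A `\` B).

(* Cardinals are represented by types up to bijection: [K] has the least
   cardinality among the types satisfying [P], which is meant to be invariant
   under bijections. *)
Definition least_cardinality (P : Type -> Prop) (K : Type) : Prop :=
  P K /\ forall L : Type, P L -> [set: K] #<= [set: L].

(* [K] represents the cardinal p. *)
Definition is_pseudo_intersection_number (K : Type) : Prop :=
  least_cardinality
    (fun L => exists F : set (set nat),
       [/\ F `<=` [set A | infinite_set A], centered F,
           ~ (exists A, pseudo_intersection F A) & [set: L] #= F])
    K.

(* Main.v *)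
Require Import Defs.
From mathcomp Require Import all_boot all_order all_algebra.
From mathcomp Require Import finmap.
From mathcomp Require Import boolp classical_sets functions cardinality.
From mathcomp Require Import reals topology function_spaces.

Set Implicit Arguments.
Unset Strict Implicit.
Unset Printing Implicit Defensive.

Local Open Scope classical_set_scope.
Local Open Scope card_scope.

(** Two implications between a type [L] and a centered family of the same or
    smaller size give the theorem; cardinal comparison does the rest, once it is
    known that every nonempty class of cardinals has a least member and that
    some centered family has no pseudo-intersection.

    From a family to a cube that is not CDH ([tall_not_cdh]).  Let [F] be
    centered, indexed by [L], without pseudo-intersection, and let [I a] be an
    independent family on a countable set.  The sets [F a `*` I a] are again
    independent, so their traces are a countable dense set of points of [2^L];
    a sequence of these points converging to the constant [true] would have
    first coordinates forming a pseudo-intersection of [F].  Adding that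
    constant gives a countable dense set with a point that is not the limit of
    any nontrivial sequence of the set.  Closing a countable dense set under
    flips of the coordinates of a fixed infinite sequence gives another one in
    which every point is such a limit.  No homeomorphism maps one to the other.

    From pseudo-intersections to homeomorphisms ([below_p_homogeneous]).
    Suppose that all centered families indexed by [L] have pseudo-intersections,
    and let [D], [D'] be countable and dense in [2^L].  Choose countably many
    coordinates [nu] separating the points of [D] and those of [D'].  A back and
    forth enumerates pairs [(q n, q' n)] of [D `*` D'], preserving the length of
    agreement along [nu].  Each new point has a parent, an earlier point
    agreeing with it for as long as possible; the step is good at [a] if
    [q (+) q'] takes at [a] the same value on the new pair as on the parent's.
    Finitely many [a] can be served at each step ([extend_pair]), and then a
    pseudo-intersection of the moves at each of the countably many finite
    histories, together with an eventual bound for [L] many functions on the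
    histories, produces a run whose steps are, for each [a], eventually good
    ([generic_branch]).  For such a run [q n a (+) q' n a] depends only on a
    finite part of [q n] ([uniform_difference]), so that adding this difference
    extends [q n |-> q' n] to a continuous map of the whole cube, and the same
    construction backwards gives its inverse. *)

(** * Cardinals *)

Lemma card_leTTP (T U : Type) :
  [set: T] #<= [set: U] <-> exists f : T -> U, injective f.
Proof.
split=> [/card_leP[f]|[f finj]].
  exists (fun x => val (f (to_setT x))) => x y /val_inj fxy.
  have : to_setT x = to_setT y by apply: (inj (f := f)) fxy; rewrite inE.
  by move/(congr1 val).
elim/Ppointed: U => U in f finj *.
  by rewrite card_le_emptyr; apply/eqP; rewrite -subset0 => t _; exact: (no (f t)).
by apply/pcard_leTP/injPex; exists f => x y _ _ /finj.
Qed.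

Lemma infinite_enum (T : Type) (A : set T) :
  infinite_set A -> exists2 f : nat -> T, injective f & forall n, A (f n).
Proof.
move=> /infiniteP; rewrite -(card_le_eqr (card_setT A)) => /card_leTTP[f finj].
exists (fun n => val (f n)); first by move=> m n /val_inj/finj.
by move=> n; exact: set_mem (valP (f n)).
Qed.

Lemma infinite_range (T : Type) (f : nat -> T) :
  injective f -> infinite_set (range f).
Proof.
move=> finj; apply/infiniteP; rewrite -(card_le_eqr (card_setT _)).
apply/card_leTTP.
exists (fun n => SigSub (mem_set (imageP f (I : [set: nat] n)))).
by move=> m n /(congr1 val) /finj.
Qed.

(** A maximal set [S] of choice functions all of whose projections are injective
    has a surjective projection, onto some [T i]: otherwise a function missing
    each projection could be added.  Inverting that projection and projecting to
    [T j] embeds [T i] in [T j]. *)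
Lemma least_card (J : Type) (T : J -> Type) :
  J -> exists i, forall j, [set: T i] #<= [set: T j].
Proof.
move=> j0.
pose P : set (set (forall j, T j)) :=
  [set S | forall j f g, S f -> S g -> f j = g j -> f = g].
have [|S [PS Smax]] := @Zorn_bigcup _ P.
  move=> C CP Ctot j f g [S CS Sf] [S' CS' S'g].
  have [/(_ _ Sf) S'f|/(_ _ S'g) Sg] := Ctot _ _ CS CS'.
    exact: (CP _ CS').
  exact: (CP _ CS).
have [[i iS]|/forallNP nS] :=
    pselect (exists i, forall t, exists f, S f /\ f i = t).
  have [g gP] := choice iS.
  exists i => j; apply/card_leTTP; exists (fun t => g t j) => t u gtu.
  have [[St <-] [Su <-]] := (gP t, gP u).
  by rewrite (PS _ _ _ St Su gtu).
have {}nS i : exists t, forall f, S f -> f i <> t.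
  by have /existsNP[t tP] := nS i; exists t => f Sf ft; apply: tP; exists f.
pose t i := sval (cid (nS i)).
have tP i f : S f -> f i <> t i by exact: (svalP (cid (nS i))).
exfalso; apply: (Smax (S `|` [set t])).
  split; first exact: subsetUl.
  by move=> /(_ t (or_intror erefl)) St; exact: (tP j0 t St).
move=> j f g [Sf|->] [Sg|->] //.
- exact: PS.
- by move=> /tP; move/(_ Sf).
- by move=> /esym /tP; move/(_ Sg).
Qed.

Lemma card_le_total (T U : Type) :
  [set: T] #<= [set: U] \/ [set: U] #<= [set: T].
Proof.
have [[] le] := least_card (fun b : bool => if b then T else U) true.
  by left; exact: le false.
by right; exact: le true.
Qed.

(** The families whose least size is the pseudo-intersection number. *)
Definition tall_centered (F : set (set nat)) : Prop :=
  [/\ F `<=` [set A | infinite_set A], centered F &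
      ~ exists A, pseudo_intersection F A].

(** A free ultrafilter: of the two halves of an infinite set it contains one or
    the complement of that one, and neither almost contains the whole set. *)
Lemma exists_tall_centered : exists F, tall_centered F.
Proof.
have ninf : infinite_set [set: nat] by exact: infinite_nat.
have [G [GU FG]] := ultraFilterLemma (frechet_properfilter ninf).
have Ginf A : G A -> infinite_set A.
  move=> GA finA; have : G (~` A).
    by apply: FG => /=; rewrite /frechet_filter /= setCK.
  by move=> /(filterI GA); rewrite setICr; exact: filter_not_empty.
exists G; split => //.
- move=> H finH _ HG; apply: Ginf.
  have [s sH] := finite_fsetP.1 finH; rewrite sH in HG *.
  by apply: filter_bigI => A /HG.
- case=> A [infA AG].
  have [f finj fA] := infinite_enum infA.
  pose B := range (fun n => f n.*2).
  have evens : infinite_set B.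
    by apply: infinite_range => m n /finj/double_inj.
  have [/AG|/AG] := in_ultra_setVsetC B GU.
    suff : infinite_set (range (fun n => f n.*2.+1)).
      move=> + H; apply; apply: sub_finite_set H => _ [n _ <-]; split=> //.
      by move=> [m _ /finj] /(congr1 odd) /=; rewrite !odd_double.
    by apply: infinite_range => m n /finj/succn_inj/double_inj.
  move=> H; apply: evens; apply: sub_finite_set H => _ [n _ <-]; split=> //.
  by apply; exists n.
Qed.

(** * The topology of the cube *)

Definition agree (L : Type) (A : set L) (x y : L -> bool) :=
  forall a, A a -> x a = y a.

(** Points agreeing with [x] on a finite set of coordinates form a base at [x];
    all topology below goes through this description. *)
Lemma nbhs_agree (L : Type) (x : {ptws L -> bool}) (U : set {ptws L -> bool}) :
  nbhs x U <-> exists2 A, finite_set A & forall y, agree A x y -> U y.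
Proof.
split=> [|[A finA AU]].
  pose F : set_system {ptws L -> bool} :=
    [set V | exists2 A, finite_set A & forall y, agree A x y -> V y].
  have FF : Filter F.
    split; first by exists set0.
      move=> P Q [A fA AP] [B fB BQ]; exists (A `|` B).
        by rewrite finite_setU.
      by move=> y xy; split; [apply: AP|apply: BQ] => a ?; apply: xy; [left|right].
    by move=> P Q PQ [A fA AP]; exists A => // y /AP/PQ.
  suff : F --> x by apply.
  apply/cvg_sup => a V [W [[O oO <-] /= Ox] OV].
  exists [set a]; first exact: finite_set1.
  by move=> y xy; apply: OV => /=; rewrite -(xy a).
elim/Pchoice: L => L in x U A finA AU *.
have [s As] := finite_fsetP.1 finA.
apply: (@filterS _ _ _
  (\bigcap_(a in [set` s]) [set y : {ptws L -> bool} | x a = y a])).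
  by move=> y xy; apply: AU => a; rewrite As; apply: xy.
apply: filter_bigI => a _.
have /cvg_sup/(_ a) : nbhs x --> x by exact: cvg_id.
apply.
exists [set y : {ptws L -> bool} | x a = y a] => //; split => //.
exists [set x a]; first exact: discrete_open.
by apply/seteqP; split => y.
Qed.

Lemma dense_agree (L : Type) (D : set {ptws L -> bool}) :
  dense D <->
  forall A x, finite_set A -> exists2 y, D y & agree A x y.
Proof.
split=> [dD A x finA|H O [x Ox] oO].
  have /dD : (fun y : {ptws L -> bool} => agree A x y)° !=set0.
    by exists x; apply/nbhs_agree; exists A.
  move=> /(_ (open_interior _))[y [/interior_subset xy Dy]].
  by exists y.
have /nbhs_agree[A finA AO] : nbhs x O by exact: open_nbhs_nbhs.
by have [y Dy /AO Oy] := H A x finA; exists y.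
Qed.

Lemma continuous_agree (L : Type) (f : {ptws L -> bool} -> {ptws L -> bool}) :
  continuous f <->
  forall (x : {ptws L -> bool}) a,
    exists2 A, finite_set A & forall y, agree A x y -> f x a = f y a.
Proof.
split=> [cf x a|H x U].
  have : nbhs x (f @^-1` [set z : {ptws L -> bool} | agree [set a] (f x) z]).
    apply: cf; apply/nbhs_agree; exists [set a] => //; exact: finite_set1.
  move=> /nbhs_agree[A finA AU]; exists A => // y /AU; exact.
move=> /nbhs_agree[B finB BU]; apply/nbhs_agree.
have [A AP] := choice (fun a => let: ex_intro2 C fC CP := H x a in
  ex_intro (fun C => finite_set C /\ forall y, agree C x y -> f x a = f y a)
    C (conj fC CP)).
exists (\bigcup_(a in B) A a).
  by apply: bigcup_finite => // a _; have [] := AP a.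
move=> y xy; apply: BU => a Ba; apply: (AP a).2 => b Ab.
by apply: xy; exists a.
Qed.

Lemma finite_nat_bound (A : set nat) :
  finite_set A -> exists N, forall n, A n -> n < N.
Proof.
move=> /finite_seqP[s ->]; exists (\max_(i <- s) i).+1 => n /= ns.
by rewrite ltnS; exact: (@leq_bigmax_seq _ s xpredT id).
Qed.

(** * Independent families and separability *)

Section independent_family.
Variables (L : Type) (j : L -> nat -> bool).
Hypothesis j_inj : injective j.

(** The classical independent family: to [a] corresponds the set of pairs
    [(N, S)] such that the initial segment of [j a] of length [N] is in [S]. *)
Definition trace_test (c : nat * seq (seq bool)) (a : L) : bool :=
  mkseq (j a) c.1 \in c.2.

(** A length [N] beyond which the finitely many sequences [j a], [a] in [A],
    are distinguished allows an arbitrary choice of those whose initial segment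
    goes into [S]. *)
Lemma trace_test_dense (A : set L) (x : L -> bool) :
  finite_set A -> exists c, agree A x (trace_test c).
Proof.
move=> finA.
have sep (p : L * L) : exists n, p.1 <> p.2 -> j p.1 n <> j p.2 n.
  have [->|ne] := pselect (p.1 = p.2); first by exists 0.
  have /existsNP[n nP] : ~ forall n, j p.1 n = j p.2 n.
    by move=> e; apply: ne; apply: j_inj; apply/funext.
  by exists n.
have [d dP] := choice sep.
have [N NP] := finite_nat_bound (finite_image d (finite_setX finA finA)).
have /finite_seqP[s sP] :
    finite_set ((fun a => mkseq (j a) N) @` [set a | A a /\ x a]).
  by apply: finite_image; apply: sub_finite_set finA => a [].
exists (N, s) => a Aa; rewrite /trace_test /=.
apply/idP/idP => [xa|ins].
  by have : [set` s] (mkseq (j a) N) by rewrite -sP; exists a.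
have : [set` s] (mkseq (j a) N) by [].
rewrite -sP => -[b [Ab xb] eab].
have [->//|ne] := pselect (a = b).
have := dP (a, b) ne; case.
have dN : d (a, b) < N by apply: NP; exists (a, b).
by rewrite -[LHS](nth_mkseq false (j a) dN) -eab nth_mkseq.
Qed.

End independent_family.

Lemma dense_agree_range (L I : Type) (e : I -> L -> bool) :
  (forall A x, finite_set A -> exists i, agree A x (e i)) ->
  dense (range e : set {ptws L -> bool}).
Proof.
by move=> H; apply/dense_agree => A x /(H _ x)[i xi]; exists (e i).
Qed.

Lemma countable_range (I : countType) (T : Type) (e : I -> T) :
  countable (range e).
Proof. exact: card_le_trans (card_image_le _ _) (countableP _). Qed.

Lemma separable_cube (L : Type) (j : L -> nat -> bool) :
  injective j -> separable_space {ptws L -> bool}.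
Proof.
move=> jinj; exists (range (trace_test j)); split; first exact: countable_range.
by apply: dense_agree_range => A x; exact: trace_test_dense.
Qed.

(** * A family without pseudo-intersection gives a cube that is not CDH *)

Lemma not_cdh_of_sequences (L : Type) (D E : set {ptws L -> bool})
    (p : {ptws L -> bool}) :
  countable D -> dense D -> D p ->
  (forall u : nat -> {ptws L -> bool}, (forall n, D (u n) /\ u n <> p) ->
    exists a, infinite_set [set n | u n a <> p a]) ->
  countable E -> dense E ->
  (forall y, E y -> exists u : nat -> {ptws L -> bool},
    (forall n, E (u n) /\ u n <> y) /\
    forall a, finite_set [set n | u n a <> y a]) ->
  ~ countable_dense_homogeneous {ptws L -> bool}.
Proof.
move=> cD dD Dp Dnocvg cE dE Ecvg [_ /(_ D E cD dD cE dE)].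
move=> [h [[g [hK gK _ /continuous_agree gc]] hDE]].
have [|u [uE ucvg]] := Ecvg (h p); first by rewrite -hDE; exists p.
have [n|a] := Dnocvg (g \o u).
  have [+ une] := uE n; rewrite -{1}hDE => -[d Dd hd] /=; split.
    by rewrite -hd hK.
  by move=> gun; apply: une; rewrite -gun gK.
apply; have [A finA AP] := gc (h p) a.
apply: (@sub_finite_set _ _ (\bigcup_(b in A) [set n | u n b <> h p b]));
  last exact: bigcup_finite.
move=> n /= gune; apply: contrapT => nA; apply: gune.
rewrite -[in RHS](hK p); apply/esym/AP => b Ab.
by apply: contrapT => ne; apply: nA; exists b => //=; exact: nesym.
Qed.

Section flips.
Variables (L : Type) (s : nat -> L).

Definition flip (i : nat) (x : L -> bool) : L -> bool :=
  fun a => x a (+) `[< a = s i >].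

Lemma flip_neq i x : flip i x <> x.
Proof.
move=> /(congr1 (@^~ (s i))); rewrite /flip asboolT //; by case: (x _).
Qed.

Lemma flip_cvg x a : injective s -> finite_set [set i | flip i x a <> x a].
Proof.
move=> sinj; apply: (@sub_finite_set _ _ (s @^-1` [set a])).
  move=> i /= ne; apply: contrapT => si; apply: ne.
  by rewrite /flip asboolF ?addbF // => /esym.
by apply: finite_preimage (finite_set1 a) => i j _ _ /sinj.
Qed.

End flips.

(** Close a countable dense set under flips at the coordinates [s i] of an
    injective sequence: the flips of [y] at [s i] tend to [y]. *)
Lemma dense_all_limits (L : Type) :
  infinite_set [set: L] -> separable_space {ptws L -> bool} ->
  exists E : set {ptws L -> bool}, [/\ countable E, dense E &
    forall y, E y -> exists u : nat -> {ptws L -> bool},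
      (forall n, E (u n) /\ u n <> y) /\
      forall a, finite_set [set n | u n a <> y a]].
Proof.
move=> /infinite_enum[s sinj _] [Q [cQ dQ]].
exists [set foldr (flip s) q.2 q.1 | q in [set: seq nat] `*` Q]; split.
- apply: card_le_trans (card_image_le _ _) _.
  exact: countableX.
- apply/dense_agree => A x /((dense_agree Q).1 dQ A x)[q Qq xq].
  by exists q => //; exists ([::], q).
- move=> _ [[c q] [_ /= Qq] <-].
  exists (fun i => flip s i (foldr (flip s) q c)); split.
    by move=> i; split; [exists (i :: c, q)|exact: flip_neq].
  by move=> a; exact: flip_cvg.
Qed.

Section tall_family.
Variables (L : Type) (F : L -> set nat).
Hypothesis F_inj : injective F.
Hypothesis F_centered : forall A : set L, finite_set A -> A !=set0 ->
  infinite_set (\bigcap_(a in A) F a).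
Hypothesis F_tall : forall X : set nat, infinite_set X ->
  exists a, infinite_set (X `\` F a).

Lemma tall_nonempty : [set: L] !=set0.
Proof. by have [a _] := F_tall infinite_nat; exists a. Qed.

Lemma tall_infinite : infinite_set [set: L].
Proof.
move=> /F_centered-/(_ tall_nonempty) /F_tall[a].
by rewrite (_ : _ `\` _ = set0) // -subset0 => n [nF]; apply; exact: nF.
Qed.

(* [~` N] is the intersection of the family, which is finite. *)
Let N := [set n | exists a, ~ F a n].

Lemma tall_meets_N (A : set L) :
  finite_set A -> exists2 n, N n & forall a, A a -> F a n.
Proof.
move=> finA; have [a0 _] := tall_nonempty.
have /F_centered inf : finite_set (a0 |` A).
  by rewrite finite_setU; split=> //; exact: finite_set1.
have {}inf : infinite_set (\bigcap_(a in a0 |` A) F a).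
  by apply: inf; exists a0; left.
apply: contrapT => H; have [a] := F_tall inf.
rewrite (_ : _ `\` _ = set0) // -subset0 => n [nA nF].
by apply: H; exists n; [exists a|move=> b Ab; apply: nA; right].
Qed.

(** The point [a |-> q \in F a `*` I a], for the independent family [I]. *)
Definition tall_point (q : nat * (nat * seq (seq bool))) : {ptws L -> bool} :=
  fun a => `[< F a q.1 >] && trace_test (fun a n => `[< F a n >]) q.2 a.

Let E := [set tall_point q | q in [set q | N q.1]].

Let Fb_inj : injective (fun a n => `[< F a n >]).
Proof.
move=> a b ab; apply: F_inj; apply/funext => n; apply/propext.
by apply: asbool_eq_equiv; exact: (congr1 (@^~ n) ab).
Qed.

Lemma tall_dense : dense E.
Proof.
apply/dense_agree => A x finA.
have [n Nn nA] := tall_meets_N finA.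
have [c xc] := trace_test_dense Fb_inj x finA.
exists (tall_point (n, c)); first by exists (n, c).
by move=> a Aa; rewrite /tall_point asboolT /= ?xc //; exact: nA.
Qed.

(** The points [u i] come from pairs with first coordinates [(q i).1].  If they
    tend to the constant [true], these first coordinates are eventually in each
    [F a]; then none of them, being in [N], is repeated infinitely often, so
    that their range is infinite, and it is a pseudo-intersection. *)
Lemma tall_not_cvg (u : nat -> {ptws L -> bool}) :
  (forall i, E (u i)) -> exists a, infinite_set [set i | u i a <> true].
Proof.
move=> uE; apply: contrapT => /forallNP fin.
have {}fin a : finite_set [set i | u i a <> true] by apply: contrapT; exact: fin.
have [q qP] := choice (fun i => let: ex_intro2 r rN ru := uE i in
  ex_intro (fun r => N r.1 /\ tall_point r = u i) r (conj rN ru)).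
have bad a : [set i | ~ F a (q i).1] `<=` [set i | u i a <> true].
  by move=> i nF /=; rewrite -(qP i).2 /tall_point asboolF.
have rinf : infinite_set (range (fun i => (q i).1)).
  move=> finr; apply: infinite_nat.
  apply: (@sub_finite_set _ _
      (\bigcup_(n in range (fun i => (q i).1)) [set i | (q i).1 = n])).
    by move=> i _; exists (q i).1 => //; exists i.
  apply: bigcup_finite => // _ [i _ <-]; have [[a nFa] _] := qP i.
  by apply: sub_finite_set (fin a) => k /= qk; apply: bad; rewrite /= qk.
have [a] := F_tall rinf; apply.
apply: sub_finite_set (finite_image (fun i => (q i).1) (fin a)).
by move=> _ [[i _ <-] nF]; exists i => //; exact: bad.
Qed.

Lemma tall_not_cdh : ~ countable_dense_homogeneous {ptws L -> bool}.
Proof.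
have [E' [cE' dE' E'cvg]] := dense_all_limits tall_infinite (separable_cube Fb_inj).
pose p : {ptws L -> bool} := fun=> true.
apply: (@not_cdh_of_sequences L (p |` E) E' p) => //.
- apply: sub_countable (countable_range (oapp tall_point p)).
  apply: subset_card_le => _ [->|[q _ <-]]; first by exists None.
  by exists (Some q).
- apply/dense_agree => A x /((dense_agree E).1 tall_dense A x)[y Ey xy].
  by exists y => //; right.
- by left.
- by move=> u uP; apply: tall_not_cvg => n; have [[]] := uP n.
Qed.

End tall_family.

(** * Consequences of having pseudo-intersections *)

(** [L] has fewer elements than the pseudo-intersection number. *)
Definition below_p (L : Type) : Prop :=
  forall F : L -> set nat,
    (forall A, finite_set A -> A !=set0 -> infinite_set (\bigcap_(a in A) F a)) ->
  exists2 X, infinite_set X & forall a, finite_set (X `\` F a).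

Lemma finite_preimage_inj (T U : Type) (f : T -> U) (A : set U) :
  injective f -> finite_set A -> finite_set (f @^-1` A).
Proof. by move=> finj; apply: finite_preimage => x y _ _ /finj. Qed.

Lemma infinite_image_inj (T U : Type) (f : T -> U) (A : set T) :
  injective f -> infinite_set A -> infinite_set (f @` A).
Proof.
move=> finj infA /(finite_preimage_inj finj); apply: contra_not infA.
by apply: sub_finite_set => x Ax; exists x.
Qed.

Section below_p_theory.
Variable L : Type.
Hypothesis L_below : below_p L.
Hypothesis L_inf : infinite_set [set: L].

Lemma below_p_countable (T : countType) (F : L -> set T) :
  (forall A, finite_set A -> A !=set0 -> infinite_set (\bigcap_(a in A) F a)) ->
  exists2 X, infinite_set X & forall a, finite_set (X `\` F a).
Proof.
move=> Fcent; have pinj := pcan_inj (@choice.pickleK T).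
have [|X Xinf XF] := L_below (F := fun a => choice.pickle @` F a).
  move=> A finA A0.
  apply: sub_infinite_set (infinite_image_inj pinj (Fcent A finA A0)).
  by move=> _ [t tA <-] a Aa; exists t => //; exact: tA.
exists (choice.pickle @^-1` X) => [|a]; last first.
  apply: sub_finite_set (finite_preimage_inj pinj (XF a)) => t [Xt nF].
  by split=> // -[u Fu /pinj ut]; apply: nF; rewrite -ut.
have [a _] := infinite_setN0 L_inf.
apply: contra_not Xinf => /(finite_image choice.pickle) fin.
apply: (@sub_finite_set _ _ (choice.pickle @` (choice.pickle @^-1` X)
    `|` (X `\` choice.pickle @` F a))); last first.
  by rewrite finite_setU; split=> //; exact: fin.
move=> n Xn; have [[t Ft tn]|nF] := pselect ((choice.pickle @` F a) n).
  by left; exists t => //; rewrite /= tn.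
by right.
Qed.

(** The inequality [p <= b].  A pseudo-intersection of the regions above the
    graphs is a partial function dominating every [g a]; replacing [g a] by its
    running maximum lets the value at the next point of the domain bound all
    earlier ones.  The domain is unbounded because the regions for [a = s i] also
    exclude the first coordinates below [i]; attaching these constraints to
    indices of [L] avoids enlarging the index set. *)
Lemma bounded_nat (g : L -> nat -> nat) :
  exists G : nat -> nat, forall a, finite_set [set n | G n < g a n].
Proof.
have [s sinj _] := infinite_enum L_inf.
pose F a : set (nat * nat) :=
  [set p | (forall k, k <= p.1 -> g a k <= p.2) /\ forall i, a = s i -> i <= p.1].
have [A finA _|X Xinf XF] := @below_p_countable _ F.
  have [N NP] := finite_nat_bound (finite_preimage_inj sinj finA).
  have bnd n : exists m, forall a k, A a -> k <= n -> g a k <= m.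
    have fin : finite_set [set g p.1 p.2 | p in A `*` `I_n.+1].
      by apply: finite_image; exact: finite_setX.
    have [m mP] := finite_nat_bound fin; exists m => a k Aa kn.
    by apply/ltnW/mP; exists (a, k).
  have [m mP] := choice bnd.
  have : infinite_set (range (fun n => (N + n, m (N + n)))).
    by apply: infinite_range => i j [/addnI].
  apply: sub_infinite_set => _ [n _ <-] a Aa; split=> /= [k|i ai].
    exact: mP.
  by apply: leq_trans (leq_addr _ _); apply/ltnW/NP; rewrite /= -ai.
have pick_ n : exists p, X p /\ n <= p.1.
  apply: contrapT => H; apply: Xinf; apply: sub_finite_set (XF (s n)) => p Xp.
  by split=> // -[_ /(_ n erefl) np]; apply: H; exists p.
have [p pP] := choice pick_.
exists (fun n => (p n).2) => a.
have [N NP] := finite_nat_bound (finite_image fst (XF a)).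
apply: (@sub_finite_set _ _ `I_N) => // n /= lt_pg.
have [Xp np] := pP n; apply: (leq_ltn_trans np); apply: NP.
exists (p n) => //; split=> // -[/(_ n np)].
by rewrite leqNgt lt_pg.
Qed.

Lemma bounded_countable (T : countType) (g : L -> T -> nat) :
  exists G : T -> nat, forall a, finite_set [set t | G t < g a t].
Proof.
have [G GP] := bounded_nat (fun a n => oapp (g a) 0 (choice.unpickle n)).
exists (G \o choice.pickle) => a.
apply: sub_finite_set (finite_preimage_inj (pcan_inj (@choice.pickleK T)) (GP a)).
by move=> t /=; rewrite choice.pickleK.
Qed.

(** The form in which the genericity of a run is used; it stands in for Martin's
    axiom for sigma-centered orders.  Let [P s] be a pseudo-intersection of the
    sets of moves at the history [s] that are good at [a], and let [g a s] bound
    the exceptions in [P s].  If [G] eventually bounds every [g a], then playing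
    at [s] a move of [P s] beyond [G s] is good at [a] for all but finitely many
    [s].  The moves are paired with natural numbers so that nonempty sets of
    moves become infinite. *)
Lemma generic_branch (T : countType) (Inv : seq T -> Prop)
    (good : L -> seq T -> T -> Prop) :
  Inv [::] ->
  (forall s, Inv s -> forall A, finite_set A ->
    exists t, Inv (rcons s t) /\ forall a, A a -> good a s t) ->
  exists x : nat -> T, (forall n, Inv (mkseq x n)) /\
    forall a, finite_set [set n | ~ good a (mkseq x n) (x n)].
Proof.
move=> Inv0 step.
have moves s : exists P : set (T * nat), Inv s ->
    [/\ infinite_set P, forall p, P p -> Inv (rcons s p.1) &
        forall a, finite_set (P `\` [set p | good a s p.1])].
  have [Is|nIs] := pselect (Inv s); last by exists set0.
  have [A finA _|P Pinf PF] := @below_p_countable _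
      (fun a => [set p : T * nat | Inv (rcons s p.1) /\ good a s p.1]).
    have [t [It gt]] := step s Is A finA.
    have : infinite_set (range (fun n : nat => (t, n))).
      by apply: infinite_range => i j [].
    by apply: sub_infinite_set => _ [n _ <-] a Aa; split=> //; exact: gt.
  have [a _] := infinite_setN0 L_inf.
  exists (P `&` [set p | Inv (rcons s p.1)]) => _; split.
  - move=> fin; have : finite_set ((P `&` [set p | Inv (rcons s p.1)]) `|`
        (P `\` [set p | Inv (rcons s p.1) /\ good a s p.1])).
      by rewrite finite_setU; split.
    move=> fin'; apply: Pinf; apply: sub_finite_set fin' => p Pp.
    have [Ip|nIp] := pselect (Inv (rcons s p.1)); [by left|right].
    by split=> // -[].
  - by move=> p [].
  - move=> b; apply: sub_finite_set (PF b) => p [[Pp Ip] ngp].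
    by split=> // -[].
have [P PP] := choice moves.
have bnd a s : exists N, Inv s ->
    forall p, P s p -> ~ good a s p.1 -> choice.pickle p < N.
  have [Is|nIs] := pselect (Inv s); last by exists 0.
  have [_ _ /(_ a)/(finite_image choice.pickle)/finite_nat_bound[N NP]] := PP s Is.
  by exists N => _ p Pp ngp; apply: NP; exists p.
have [g gP] := choice (fun q : L * seq T => bnd q.1 q.2).
have [G GP] := bounded_countable (fun a s => g (a, s)).
have next_ s : exists p, Inv s -> P s p /\ G s <= choice.pickle p.
  have [Is|nIs] := pselect (Inv s); last first.
    by have [/infinite_setN0[p _] _ _] := PP [::] Inv0; exists p.
  have [Pinf _ _] := PP s Is.
  have [p Pp /negP sp] : exists2 p, P s p & ~ choice.pickle p < G s.
    apply: contrapT => H; apply: Pinf.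
    apply: sub_finite_set (finite_preimage_inj
      (pcan_inj (@choice.pickleK (T * nat)%type)) (finite_II (G s))).
    by move=> p Pp; apply: contrapT => ?; apply: H; exists p.
  by exists p => _; split=> //; rewrite leqNgt.
have [next nextP] := choice next_.
pose hist := fix hist n :=
  if n is m.+1 then rcons (hist m) (next (hist m)).1 else [::].
pose x n := (next (hist n)).1.
have histE n : mkseq x n = hist n by elim: n => // n IH; rewrite mkseqS IH.
have histI n : Inv (hist n).
  elim: n => // n IH /=; have [Pn _] := nextP _ IH.
  by have [_ /(_ _ Pn)] := PP _ IH.
exists x; split=> [n|a]; first by rewrite histE.
have hist_inj : injective hist.
  by move=> m n mn; rewrite -(size_mkseq x m) -(size_mkseq x n) !histE mn.
apply: sub_finite_set (finite_preimage_inj hist_inj (GP a)) => n /=.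
rewrite histE => ngood; have [Pn Gn] := nextP _ (histI n).
by apply: leq_ltn_trans Gn _; exact: (gP (a, hist n) (histI n) _ Pn ngood).
Qed.
End below_p_theory.

(** * Back and forth *)

Section back_and_forth.
Variables (L : Type) (nu : nat -> L).

Definition near_upto (k : nat) (x y : L -> bool) :=
  forall i, i < k -> x (nu i) = y (nu i).

Lemma near_sym k x y : near_upto k x y -> near_upto k y x.
Proof. by move=> xy i /xy. Qed.

Lemma near_trans k x y z : near_upto k x y -> near_upto k y z -> near_upto k x z.
Proof. by move=> xy yz i ik; rewrite xy // yz. Qed.

Lemma near_le k l x y : l <= k -> near_upto k x y -> near_upto l x y.
Proof. by move=> lk xy i il; apply/xy/(leq_trans il). Qed.

Definition splits_at (k : nat) (x y : L -> bool) :=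
  near_upto k x y /\ x (nu k) <> y (nu k).

Lemma splits_near k x y l : splits_at k x y -> (near_upto l x y <-> l <= k).
Proof.
move=> [xy ne]; split=> [lxy|lk]; last exact: near_le xy.
by rewrite leqNgt; apply/negP => kl; apply: ne; exact: lxy.
Qed.

Lemma splits_exists x y : ~ (forall n, x (nu n) = y (nu n)) ->
  exists k, splits_at k x y.
Proof.
move=> /existsNP[n /eqP ne].
have ex : exists n, x (nu n) != y (nu n) by exists n.
exists (ex_minn ex); case: ex_minnP => m /eqP mne mmin; split=> // i im.
by apply: contrapT => /eqP /mmin; rewrite leqNgt im.
Qed.

(** One step, giving the new point [d m] a partner.  The parent [p] splits from
    [d m] as late as possible, at [k].  By density there is a point [d' b] with
    the parent's difference on [A] and on the coordinates [nu i] for [i <= k];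
    then [d' b] splits from [d' p.2] exactly at [k].  Among two-valued points
    this fixes where it splits from each other [d' q.2]: if [d q.1] also splits
    from [d m] at [k], then it agrees with [d p.1] beyond [k], and otherwise it
    splits from [d p.1] where it splits from [d m]. *)
Lemma extend_pair (d d' : nat -> L -> bool) (s : seq (nat * nat)) (m : nat)
    (A : set L) :
  (forall i j, (forall n, d i (nu n) = d j (nu n)) -> d i = d j) ->
  (forall B x, finite_set B -> exists i, agree B x (d' i)) ->
  (forall p q k, p \in s -> q \in s ->
    near_upto k (d p.1) (d q.1) <-> near_upto k (d' p.2) (d' q.2)) ->
  finite_set A ->
  exists b,
    (forall q k, q \in s ->
      near_upto k (d m) (d q.1) <-> near_upto k (d' b) (d' q.2)) /\
    (s = [::] \/ exists p, [/\ p \in s,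
      forall q k, q \in s -> near_upto k (d m) (d q.1) -> near_upto k (d m) (d p.1) &
      forall a, A a -> d m a (+) d' b a = d p.1 a (+) d' p.2 a]).
Proof.
move=> dsep d'dense iso finA.
have [s0|/eqP s0] := eqVneq s [::]; first by exists 0; rewrite s0; split; [|left].
have [[p ps dp]|old] := pselect (exists2 p, p \in s & d m = d p.1).
  exists p.2; split=> [q k qs|]; first by rewrite dp; exact: iso.
  by right; exists p; split=> // [q k _ _|a _]; rewrite dp.
have split_ q : exists k, q \in s -> splits_at k (d m) (d q.1).
  have [qs|] := boolP (q \in s); last by exists 0.
  have [|k kP] := @splits_exists (d m) (d q.1); last by exists k.
  by move=> /dsep mq; apply: old; exists q.
have [k kP] := choice split_.
have [p ps pmax] : exists2 p, p \in s & forall q, q \in s -> k q <= k p.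
  elim: (s) s0 => // q0 [|q1 r] IH _.
    by exists q0 => [|q]; rewrite inE // => /eqP->.
  have [//|p ps pmax] := IH.
  have [le|lt] := leqP (k q0) (k p).
    exists p => [|q]; first by rewrite inE ps orbT.
    by rewrite inE => /orP[/eqP->//|/pmax].
  exists q0 => [|q]; first by rewrite inE eqxx.
  by rewrite inE => /orP[/eqP->//|/pmax/leq_trans]; apply; exact: ltnW.
have finB : finite_set (A `|` nu @` `I_(k p).+1).
  by rewrite finite_setU; split=> //; exact: finite_image.
have [b bP] := d'dense _ (fun a => d' p.2 a (+) (d m a (+) d p.1 a)) finB.
(* On [A] and on [nu i], [i <= k p], the difference between [d' b] and [d m]
   is the one between [d' p.2] and [d p.1]. *)
have {}bP : [/\ forall a, A a -> d' b a = d' p.2 a (+) (d m a (+) d p.1 a) &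
   forall i, i <= k p -> d' b (nu i) = d' p.2 (nu i) (+) (d m (nu i) (+) d p.1 (nu i))].
  split=> [a Aa|i ik]; rewrite -bP //; first by left.
  by right; exists i.
have [bA bnu] := bP.
have [mp mpk] := kP p ps.
have bp : splits_at (k p) (d' b) (d' p.2).
  split=> [i ik|].
    by rewrite bnu ?(ltnW ik) // mp // addbb addbF.
  rewrite bnu // => e; apply: mpk; move: e.
  by case: (d' p.2 _) (d m _) (d p.1 _) => [] [] [].
exists b; split=> [q j qs|]; last first.
  right; exists p; split=> // [q j qs mq|a Aa].
    apply: near_le mp; apply: leq_trans (pmax q qs).
    by apply/(splits_near j (kP q qs)).
  rewrite bA //; by case: (d' p.2 _) (d m _) (d p.1 _) => [] [] [].
have [mq mqk] := kP q qs.
suff bq : splits_at (k q) (d' b) (d' q.2).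
  by rewrite (splits_near j (kP q qs)) (splits_near j bq).
have := pmax q qs; rewrite leq_eqVlt => /orP[/eqP kqp|kqp].
  have : near_upto (k p).+1 (d p.1) (d q.1).
    move=> i; rewrite ltnS leq_eqVlt => /orP[/eqP->|ik].
      move: mpk mqk; rewrite kqp.
      by case: (d q.1 _) (d m _) (d p.1 _) => [] [] [].
    by rewrite -mp // mq // kqp.
  rewrite (iso p q) // => pq; rewrite kqp; case: bp => bp bpk; split.
    exact: near_trans bp (near_le (leqnSn _) pq).
  by rewrite -pq.
have pq : near_upto (k q) (d' p.2) (d' q.2).
  rewrite -iso //; apply: near_trans mq; apply: near_sym.
  exact: near_le (ltnW kqp) mp.
split; first exact: near_trans (near_le (ltnW kqp) bp.1) pq.
rewrite bp.1 // => e; apply: mqk; rewrite mp //.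
have : near_upto (k q).+1 (d p.1) (d q.1); last by apply.
apply/iso => // i; rewrite ltnS leq_eqVlt => /orP[/eqP->//|]; exact: pq.
Qed.

(** Even steps take care of the points of [d], odd steps of those of [d']; since
    the matching preserves agreement lengths, [extend_pair] applies with the two
    sides exchanged and yields the same notion of parent. *)
Lemma generic_matching (d d' : nat -> L -> bool) :
  below_p L -> infinite_set [set: L] ->
  (forall i j, (forall n, d i (nu n) = d j (nu n)) -> d i = d j) ->
  (forall i j, (forall n, d' i (nu n) = d' j (nu n)) -> d' i = d' j) ->
  (forall B x, finite_set B -> exists i, agree B x (d i)) ->
  (forall B x, finite_set B -> exists i, agree B x (d' i)) ->
  exists x : nat -> nat * nat,
  [/\ forall m, exists n, (x n).1 = m, forall m, exists n, (x n).2 = m,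
      forall n m k, near_upto k (d (x n).1) (d (x m).1) <->
                    near_upto k (d' (x n).2) (d' (x m).2) &
      forall a, exists N, forall n, N <= n -> exists i, [/\ i < n,
        forall l k, l < n -> near_upto k (d (x n).1) (d (x l).1) ->
                    near_upto k (d (x n).1) (d (x i).1) &
        d (x n).1 a (+) d' (x n).2 a = d (x i).1 a (+) d' (x i).2 a]].
Proof.
move=> below infL dsep d'sep ddense d'dense.
pose iso (p q : nat * nat) := forall k, near_upto k (d p.1) (d q.1) <->
  near_upto k (d' p.2) (d' q.2).
have iso_sym p q : iso p q -> iso q p.
  move=> pq k; split=> /near_sym/pq/near_sym; exact.
have iso_refl p : iso p p by [].
pose Inv (s : seq (nat * nat)) :=
  (forall p q, p \in s -> q \in s -> iso p q) /\
  forall i, i < size s -> let p := nth (0, 0) s i in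
    if odd i then p.2 = i./2 else p.1 = i./2.
pose good a (s : seq (nat * nat)) (t : nat * nat) := s = [::] \/
  exists p, [/\ p \in s,
      forall q k, q \in s -> near_upto k (d t.1) (d q.1) ->
        near_upto k (d t.1) (d p.1) &
      d t.1 a (+) d' t.2 a = d p.1 a (+) d' p.2 a].
have [|s [siso ssched] A finA|x [xI xgood]] :=
    @generic_branch L below infL (nat * nat)%type Inv good.
- by split.
- suff [t [tsched tiso tgood]] : exists t, [/\
      if odd (size s) then t.2 = (size s)./2 else t.1 = (size s)./2,
      forall q, q \in s -> iso t q & forall a, A a -> good a s t].
    exists t; split=> //; split=> [p q|i].
      rewrite !mem_rcons !inE => /orP[/eqP->|ps] /orP[/eqP->|qs] //.
      - exact: tiso.
      - exact/iso_sym/tiso.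
      - exact: siso.
    rewrite size_rcons ltnS leq_eqVlt nth_rcons => /orP[/eqP->|ilt].
      by rewrite ltnn eqxx.
    by rewrite ilt; exact: ssched.
  have [odds|evens] := boolP (odd (size s)).
    pose s' := [seq (p.2, p.1) | p <- s].
    have s'P p : p \in s' -> (p.2, p.1) \in s.
      by move=> /mapP[q qs ->]; rewrite -surjective_pairing.
    have [p q k /s'P ps /s'P qs|b [biso bgood]] :=
        @extend_pair d' d s' (size s)./2 A d'sep ddense _ finA.
      exact: iff_sym (siso _ _ ps qs k).
    have tiso q : q \in s -> iso (b, (size s)./2) q.
      move=> qs k; apply: iff_sym; apply: (biso (q.2, q.1)).
      by apply/mapP; exists q.
    exists (b, (size s)./2); split=> // a Aa.
    case: bgood => [s'0|[p [/s'P ps pmax pA]]].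
      by left; apply/nilP; move/(congr1 size)/eqP: s'0; rewrite size_map.
    right; exists (p.2, p.1); split=> //= [q k qs bq|].
      apply/(tiso _ ps)/(pmax (q.2, q.1)); first by apply/mapP; exists q.
      by apply/(tiso _ qs).
    by rewrite addbC pA // addbC.
  have [b [biso bgood]] :=
    extend_pair (size s)./2 dsep d'dense (fun p q k ps qs => siso p q ps qs k) finA.
  exists ((size s)./2, b); split=> // [q qs k|a Aa]; first exact: biso.
  case: bgood => [->|[p [ps pmax pA]]]; first by left.
  by right; exists p; split=> //; exact: pA.
have xnth n i : i < n -> nth (0, 0) (mkseq x n) i = x i by move=> ?; rewrite nth_mkseq.
have xin n i : i < n -> x i \in mkseq x n.
  by move=> ?; apply/mapP; exists i => //; rewrite mem_iota.
have xsched i : if odd i then (x i).2 = i./2 else (x i).1 = i./2.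
  have [_ /(_ i)] := xI i.+1; rewrite size_mkseq => /(_ (ltnSn i)).
  by rewrite xnth.
exists x; split.
- by move=> m; exists m.*2; have := xsched m.*2; rewrite odd_double doubleK.
- move=> m; exists m.*2.+1; have := xsched m.*2.+1.
  by rewrite /= odd_double /= uphalf_double.
- move=> n m; have [xiso _] := xI (maxn n m).+1.
  by apply: xiso; apply: xin; rewrite ltnS ?leq_maxl ?leq_maxr.
- move=> a; have [N NP] := finite_nat_bound (xgood a).
  exists N.+1 => n Nn.
  have : good a (mkseq x n) (x n).
    by apply: contrapT => /NP; rewrite ltnNge (ltnW Nn).
  case=> [/(congr1 size)|[p [/mapP[i]]]].
    by rewrite size_mkseq => n0; rewrite n0 in Nn.
  rewrite mem_iota /= => ltin -> pmax pa; exists i; split=> // l k ln.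
  by apply: pmax; exact: xin.
Qed.

End back_and_forth.

(** * Homogeneity of the cube *)

Section matched_sequences.
Variables (L : Type) (nu : nat -> L).

(** [K] exceeds all the splitting levels among the points enumerated before the
    steps become good at [a].  Of two points agreeing up to [K], the later one
    may be replaced by its parent, which by maximality agrees with both up to
    [K]; descending in this way leads to two early points, which coincide. *)
Lemma uniform_difference (q q' : nat -> L -> bool) (a : L) :
  (forall i j, (forall n, q i (nu n) = q j (nu n)) -> q i = q j) ->
  (forall i j, (forall n, q' i (nu n) = q' j (nu n)) -> q' i = q' j) ->
  (forall n m k, near_upto nu k (q n) (q m) <-> near_upto nu k (q' n) (q' m)) ->
  (exists N, forall n, N <= n -> exists i, [/\ i < n,
    forall l k, l < n -> near_upto nu k (q n) (q l) -> near_upto nu k (q n) (q i) &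
    q n a (+) q' n a = q i a (+) q' i a]) ->
  exists K, forall n m, near_upto nu K (q n) (q m) ->
    q n a (+) q' n a = q m a (+) q' m a.
Proof.
move=> qsep q'sep iso [N NP].
have sep (p : nat * nat) : exists k, near_upto nu k (q p.1) (q p.2) ->
    q p.1 a (+) q' p.1 a = q p.2 a (+) q' p.2 a.
  have [e|ne] := pselect (forall n, q p.1 (nu n) = q p.2 (nu n)).
    exists 0 => _; rewrite (qsep _ _ e); congr (_ (+) _).
    have -> // : q' p.1 = q' p.2.
    apply: q'sep => n; suff : near_upto nu n.+1 (q' p.1) (q' p.2) by apply.
    by apply/iso => i _; exact: e.
  have [k kP] := splits_exists ne; exists k.+1.
  by move/(splits_near k.+1 kP); rewrite ltnn.
have [k kP] := choice sep.
have [K KP] := finite_nat_bound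
  (finite_image k (finite_setX (finite_II N) (finite_II N))).
have small i j : i < N -> j < N -> near_upto nu K (q i) (q j) ->
    q i a (+) q' i a = q j a (+) q' j a.
  move=> iN jN ij; apply: (kP (i, j)); apply: near_le ij.
  by apply/ltnW/KP; exists (i, j).
suff main n : forall m, m <= n -> near_upto nu K (q n) (q m) ->
    q n a (+) q' n a = q m a (+) q' m a.
  exists K => n m nm; have [mn|/ltnW nm'] := leqP m n; first exact: main.
  by apply/esym/main => //; exact: near_sym.
have [n'] := ubnP n; elim: n' n => // n' IH n; rewrite ltnS => nn' m mn nm.
move: mn; rewrite leq_eqVlt => /orP[/eqP->//|mn].
have [nN|/NP[i [lt_in imax ->]]] := ltnP n N.
  by apply: small => //; exact: ltn_trans mn nN.
have ni := imax m K mn nm.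
have im := near_trans (near_sym ni) nm.
have [mi|/ltnW im'] := leqP m i; first by apply: IH => //; exact: leq_trans lt_in nn'.
apply/esym/IH => //; first exact: leq_trans mn _.
exact: near_sym.
Qed.

(** Near [x], the difference [q (+) q'] at [a] is read off from any [q n] that
    agrees with [x] up to [K a]. *)
Lemma extend_matching (q q' : nat -> {ptws L -> bool}) :
  (forall B x, finite_set B -> exists i, agree B x (q i)) ->
  (forall a, exists K, forall n m, near_upto nu K (q n) (q m) ->
    q n a (+) q' n a = q m a (+) q' m a) ->
  exists h : {ptws L -> bool} -> {ptws L -> bool},
    continuous h /\ forall n, h (q n) = q' n.
Proof.
move=> qdense /choice[K KP].
have /choice[c cP] (r : {ptws L -> bool} * L) :
    exists n, near_upto nu (K r.2) r.1 (q n).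
  have [|n nP] := qdense (nu @` `I_(K r.2)) r.1; first exact: finite_image.
  by exists n => i iK; apply: nP; exists i.
pose h (x : {ptws L -> bool}) : {ptws L -> bool} :=
  fun a => x a (+) (q (c (x, a)) a (+) q' (c (x, a)) a).
exists h; split=> [|n].
  apply/continuous_agree => x a; exists (a |` nu @` `I_(K a)).
    by rewrite finite_setU; split; [exact: finite_set1|exact: finite_image].
  move=> y xy; rewrite /h -(xy a); last by left.
  congr (_ (+) _); apply: KP; apply: near_trans (cP (y, a)) => /=.
  apply: near_trans (near_sym (cP (x, a))) _ => i iK.
  by apply: xy; right; exists i.
apply/funext => a; rewrite /h (KP a _ n); last exact/near_sym/(cP (q n, a)).
by rewrite addbA addbb.
Qed.

End matched_sequences.

Lemma continuous_id_on_dense (L : Type) (f : {ptws L -> bool} -> {ptws L -> bool})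
    (q : nat -> {ptws L -> bool}) :
  continuous f -> (forall B x, finite_set B -> exists i, agree B x (q i)) ->
  (forall n, f (q n) = q n) -> forall x, f x = x.
Proof.
move=> /continuous_agree fc qdense fq x; apply/funext => a.
have [A finA AP] := fc x a.
have [|n xn] := qdense (a |` A) x.
  by rewrite finite_setU; split=> //; exact: finite_set1.
rewrite (AP (q n)); last by move=> b Ab; apply: xn; right.
by rewrite fq xn //; left.
Qed.

Lemma dense_enum (L : Type) (D : set {ptws L -> bool}) :
  countable D -> dense D -> exists d : nat -> {ptws L -> bool},
    range d = D /\ forall B x, finite_set B -> exists i, agree B x (d i).
Proof.
move=> /pfcard_geP[D0 /dense_agree dD|/surjfunPex[d Dd] /dense_agree dD].
  by have [y] := dD set0 (fun=> true) (finite_set0 _); rewrite D0.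
exists d; split=> // B x finB; have [y] := dD B x finB.
by rewrite Dd => -[i _ <-]; exists i.
Qed.

Lemma separating_sequence (L : Type) (a0 : L) (f : nat -> L -> bool) :
  exists nu : nat -> L,
    forall i j, (forall n, f i (nu n) = f j (nu n)) -> f i = f j.
Proof.
have /choice[c cP] (p : nat * nat) : exists a, f p.1 a = f p.2 a -> f p.1 = f p.2.
  have [e|ne] := pselect (forall a, f p.1 a = f p.2 a).
    by exists a0 => _; apply/funext.
  by have /existsNP[a aP] := ne; exists a.
exists (fun n => oapp c a0 (choice.unpickle n)) => i j e.
by apply: (cP (i, j)); have := e (choice.pickle (i, j)); rewrite choice.pickleK.
Qed.

Lemma below_p_homogeneous (L : Type) (D D' : set {ptws L -> bool}) :
  below_p L -> infinite_set [set: L] ->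
  countable D -> dense D -> countable D' -> dense D' ->
  exists h : {ptws L -> bool} -> {ptws L -> bool}, homeomorphism h /\ h @` D = D'.
Proof.
move=> below infL cD dD cD' dD'.
have [d [dDE ddense]] := dense_enum cD dD.
have [d' [d'DE d'dense]] := dense_enum cD' dD'.
have [a0 _] := infinite_setN0 infL.
have [nu nuP] := separating_sequence a0
  (fun n => if odd n then d' n./2 else d n./2).
have dsep i j : (forall n, d i (nu n) = d j (nu n)) -> d i = d j.
  by move=> e; have := nuP i.*2 j.*2; rewrite !odd_double !doubleK; exact.
have d'sep i j : (forall n, d' i (nu n) = d' j (nu n)) -> d' i = d' j.
  move=> e; have := nuP i.*2.+1 j.*2.+1.
  by rewrite /= !odd_double /= !uphalf_double; exact.
have [x [x1 x2 iso par]] := generic_matching below infL dsep d'sep ddense d'dense.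
pose q n := d (x n).1; pose q' n := d' (x n).2.
have qdense B y : finite_set B -> exists i, agree B y (q i).
  move=> finB; have [m ym] := ddense B y finB.
  by have [n xn] := x1 m; exists n; rewrite /q xn.
have q'dense B y : finite_set B -> exists i, agree B y (q' i).
  move=> finB; have [m ym] := d'dense B y finB.
  by have [n xn] := x2 m; exists n; rewrite /q' xn.
have diff a : exists K, forall n m, near_upto nu K (q n) (q m) ->
    q n a (+) q' n a = q m a (+) q' m a.
  apply: uniform_difference => // [i j|i j|].
  - exact: dsep.
  - exact: d'sep.
  - exact: par.
have diff' a : exists K, forall n m, near_upto nu K (q' n) (q' m) ->
    q' n a (+) q n a = q' m a (+) q m a.
  by have [K KP] := diff a; exists K => n m /iso/KP; rewrite addbC => ->; rewrite addbC.
have [h [hc hq]] := extend_matching qdense diff.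
have [g [gc gq]] := extend_matching q'dense diff'.
exists h; split.
  exists g; split=> //.
  - apply: (@continuous_id_on_dense L (g \o h) q) => [y|//|n] /=.
      by apply: continuous_comp; [exact: hc|exact: gc].
    by rewrite hq gq.
  - apply: (@continuous_id_on_dense L (h \o g) q') => [y|//|n] /=.
      by apply: continuous_comp; [exact: gc|exact: hc].
    by rewrite gq hq.
rewrite -dDE -d'DE; apply/seteqP; split.
  by move=> _ [_ [m _ <-] <-]; have [n <-] := x1 m; exists (x n).2 => //; exact/esym/hq.
by move=> _ [m _ <-]; have [n <-] := x2 m; exists (q n); [exists (x n).1|rewrite hq].
Qed.

Lemma finite_cube_cdh (L : Type) :
  finite_set [set: L] -> countable_dense_homogeneous {ptws L -> bool}.
Proof.
move=> finL; split.
  have /countable_injP[f finj] := finite_set_countable finL.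
  apply: (@separable_cube L (fun a n => f a == n)) => a b ab.
  apply: finj; rewrite ?inE //.
  by have := congr1 (@^~ (f b)) ab; rewrite eqxx => /eqP.
have full (D : set {ptws L -> bool}) : dense D -> D = setT.
  move=> /dense_agree dD; apply/seteqP; split=> // x _.
  have [y Dy xy] := dD _ x finL; rewrite (_ : x = y) //.
  by apply/funext => a; exact: xy.
move=> D D' _ /full-> _ /full->; exists id; split; last exact: image_id.
by exists id; split=> // x; exact: cvg_id.
Qed.

Lemma tall_centered_not_cdh (L : Type) (F : set (set nat)) :
  tall_centered F -> [set: L] #= F ->
  ~ countable_dense_homogeneous {ptws L -> bool}.
Proof.
move=> [_ Fcent Ftall] /card_set_bijP[f [fF finj fsurj]].
apply: (@tall_not_cdh L f).
- by move=> a b; apply: finj; rewrite inE.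
- move=> A finA [a Aa]; rewrite -(bigcap_image A f id).
  apply: Fcent; first exact: finite_image.
    by exists (f a); exists a.
  by move=> _ [b _ <-]; exact: fF.
- move=> X Xinf; apply: contrapT => /forallNP Xf; apply: Ftall.
  exists X; split=> // B FB.
  by have [a _ <-] := fsurj B FB; apply: contrapT; exact: Xf.
Qed.

(** If [L] does not embed in the continuum, then every family of sets of naturals
    embeds in [L].  Otherwise the cube is separable, and an infinite [L] that is
    at least as large as no tall family satisfies [below_p], so that
    [below_p_homogeneous] applies. *)
Lemma not_cdh_tall_centered (L : Type) :
  ~ countable_dense_homogeneous {ptws L -> bool} ->
  exists2 F, tall_centered F & F #<= [set: L].
Proof.
move=> ncdh; apply: contrapT => noF; apply: ncdh.
have [finL|infL] := pselect (finite_set [set: L]); first exact: finite_cube_cdh.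
have below : below_p L.
  move=> F Fcent; apply: contrapT => nX; apply: noF; exists (range F).
    split.
    - move=> _ [a _ <-] /=; have := Fcent [set a] (finite_set1 a).
      by rewrite bigcap_set1; apply; exists a.
    - move=> G finG [A GA] GF.
      have /choice[c cP] (B : set nat) : exists a, G B -> F a = B.
        have [/GF[a _ <-]|nGB] := pselect (G B); first by exists a.
        by have [a _] := infinite_setN0 infL; exists a.
      have : infinite_set (\bigcap_(a in c @` G) F a).
        by apply: Fcent; [exact: finite_image|exists (c A); exists A].
      by apply: sub_infinite_set => n nc B GB; rewrite -(cP B GB); apply: nc; exists B.
    - by move=> [X [Xinf XF]]; apply: nX; exists X => // a; apply: XF; exists a.
  exact: card_image_le.
split; last by move=> D D' cD dD cD' dD'; exact: below_p_homogeneous.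
have [/card_leTTP[f finj]|le] := card_le_total L (set nat).
  apply: (@separable_cube L (fun a n => `[< f a n >])) => a b ab.
  apply: finj; apply/funext => n; apply/propext.
  by apply: asbool_eq_equiv; exact: (congr1 (@^~ n) ab).
exfalso; apply: noF; have [F FP] := exists_tall_centered.
by exists F => //; apply: card_le_trans (card_leT _) le.
Qed.

Theorem theorem3p3 :
  (exists K : Type, is_pseudo_intersection_number K) /\
  (forall K : Type,
     is_pseudo_intersection_number K <->
     least_cardinality
       (fun L : Type => ~ countable_dense_homogeneous {ptws L -> bool}) K).
Proof.
split.
  have [F0 F0P] := exists_tall_centered.
  have [[F FP] Fmin] := @least_card {F : set (set nat) | tall_centered F}
    (fun F => set_type (sval F)) (exist _ F0 F0P).
  exists (set_type F); split.
    by exists F; have [] := FP; split=> //; exact: card_setT.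
  move=> L [G [Ginf Gcent Gtall LG]].
  have := Fmin (exist _ G (And3 Ginf Gcent Gtall)) => /= /card_le_trans; apply.
  by rewrite (card_le_eql (card_setT _)) (card_le_eqr LG).
move=> K; split=> -[KP Kmin]; split.
- by have [F [Finf Fcent Ftall KF]] := KP; exact: tall_centered_not_cdh KF.
- move=> L /not_cdh_tall_centered[F [Finf Fcent Ftall] FL].
  apply: card_le_trans FL; rewrite -(card_le_eqr (card_setT F)).
  by apply: Kmin; exists F; split=> //; exact: card_setT.
- have [F FP FK] := not_cdh_tall_centered KP.
  exists F; have [Finf Fcent Ftall] := FP; split=> //.
  apply: Cantor_Bernstein => //; rewrite -(card_le_eqr (card_setT F)).
  by apply: Kmin; apply: tall_centered_not_cdh FP _; exact: card_setT.
- move=> L [F [Finf Fcent Ftall LF]]; apply: Kmin.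
  exact: tall_centered_not_cdh LF.
Qed.
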